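(* Let $w:[0,\infty)\to\mathbb{R}$ be a solution to (P) with initial value $\alpha$, where $0<\alpha<(1-p)^{1/(1-p)}$. Then, for any $\epsilon>0$, there exist constants $c_{1\epsilon},c_{2\epsilon}>0$ such that $$|w(\eta)|<\frac{c_{1\epsilon}}{\eta^{\frac{2}{(1-p)}-\epsilon}}\qquad\forall\,\eta\in(0,\infty),$$ $$|w'(\eta)|<\frac{c_{2\epsilon}}{\eta^{\frac{(1+p)}{(1-p)}-\epsilon}}\qquad\forall\,\eta\in(0,\infty).$$
   Context: Let $n\in\mathbb{N}$ and $0<p<1$ be fixed. Let $H:\mathbb{R}\to\mathbb{R}$ be given by $H(w)=\frac{1}{1-p}w-w|w|^{p-1}$ for $w\neq0$ and $H(0)=0$. For $\alpha\in[0,(1-p)^{1/(1-p)}]$, a solution to (P) with initial value $\alpha$ is a function $w\in C^2([0,\infty))\cap L^\infty([0,\infty))$ with $w(0)=\alpha$, $w'(0)=0$ and $$w''+\left(\frac{n-1}{\eta}+\frac{\eta}{2}\right)w'-H(w)=0\qquad\forall\,\eta\in(0,\infty).$$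
   Formalization: ε is restricted to 0 < ε ≤ 2/(1−p): for larger ε both bounds fail as η → 0, since the right-hand side for w tends to 0 while w(0) = α > 0, and w'(η) ~ H(α)η/n with H(α) < 0. *)

(* Defs.v *)
(* Stdlib real numbers [R], with Coquelicot's total derivative [Derive]. *)
From Stdlib Require Import Reals.
From Coquelicot Require Import Coquelicot.
Open Scope R_scope.

(* [Rpower 0 y] is a junk value in Stdlib, hence the explicit case w = 0. *)
Definition H (p w : R) : R :=
  if Req_dec_T w 0 then 0
  else 1 / (1 - p) * w - w * Rpower (Rabs w) (p - 1).

(* f is C^2 on D with derivatives f1 and f2.  Difference quotients are taken
   within D ([D_in]), so at an endpoint of D the derivatives are one-sided and
   values outside D are irrelevant. *)
Definition C2_on (D : R -> Prop) (f f1 f2 : R -> R) : Prop :=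
  forall x, D x -> D_in f f1 D x /\ D_in f1 f2 D x /\ continue_in f2 D x.

(* Since w is continuous on [0, oo), w is in L^oo iff it is bounded there. *)
Definition solution (n : nat) (p alpha : R) (w : R -> R) : Prop :=
  exists w1 w2 : R -> R,
    C2_on (fun eta => 0 <= eta) w w1 w2 /\
    (exists M, forall eta, 0 <= eta -> Rabs (w eta) <= M) /\
    w 0 = alpha /\ w1 0 = 0 /\
    (forall eta, 0 < eta ->
      w2 eta + ((INR n - 1) / eta + eta / 2) * w1 eta - H p (w eta) = 0).

(* Main.v *)
(* With P = |w|^(1+p), U = potential and v = w', the energy v^2/2 + U(w) does not
   increase, which confines |w| to [0, alpha], where U(w) and -w H(w) are both
   comparable to P.  For K > 0 put F = v^2/2 + U(w) + (K/t) w v.  The damping t/2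
   turns the derivative of the last term into a cross term K w v / 2, which is
   absorbed by t v^2 and K P / t as soon as w^2 <= b P with K b small, and then
   F' <= -(kappa/t) F for large t with kappa proportional to K, i.e.
   F = O(t^(-kappa)).  A first pass with small K, allowed by confinement alone,
   gives w -> 0; hence w^2 <= b P eventually for every b > 0, and a second pass
   with K as large as desired gives any polynomial rate. *)
Require Import Defs.
From Stdlib Require Import Reals Lra Psatz.
From Coquelicot Require Import Coquelicot.
Open Scope R_scope.

(** * Powers of |x|, the potential of the nonlinearity, and their comparison *)

(** The value 0 at x = 0 is imposed for every exponent, so that exponents add there without sign
    conditions. *)
Definition abs_pow (q x : R) : R :=
  if Req_dec_T x 0 then 0 else Rpower (Rabs x) q.

(** The antiderivative of -H that vanishes at 0, so that v^2/2 + U(w) is the mechanical energy of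
    the damped equation. *)
Definition potential (p x : R) : R :=
  abs_pow (1 + p) x / (1 + p) - x ^ 2 / (2 * (1 - p)).

Lemma Rpower_root (x a : R) : 0 < x -> a <> 0 -> Rpower (Rpower x (1 / a)) a = x.
Proof.
  intros Hx Ha. rewrite Rpower_mult. replace (1 / a * a) with 1 by (field; lra).
  now apply Rpower_1.
Qed.

Lemma abs_pow_ge0 (q x : R) : 0 <= abs_pow q x.
Proof.
  unfold abs_pow. destruct (Req_dec_T x 0); [lra|].
  apply Rlt_le, exp_pos.
Qed.

Lemma abs_pow_abs (q x : R) : abs_pow q (Rabs x) = abs_pow q x.
Proof.
  unfold abs_pow. rewrite Rabs_Rabsolu.
  destruct (Req_dec_T x 0) as [->|Hx].
  - rewrite Rabs_R0. destruct (Req_dec_T 0 0); lra.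
  - destruct (Req_dec_T (Rabs x) 0) as [E|]; [|reflexivity].
    now apply Rabs_eq_0 in E.
Qed.

Lemma abs_pow_add (q r x : R) : abs_pow (q + r) x = abs_pow q x * abs_pow r x.
Proof.
  unfold abs_pow. destruct (Req_dec_T x 0); [ring|]. apply Rpower_plus.
Qed.

Lemma abs_pow_2 (x : R) : abs_pow 2 x = x ^ 2.
Proof.
  unfold abs_pow. destruct (Req_dec_T x 0) as [->|Hx]; [ring|].
  replace 2 with (INR 2) by (simpl; ring).
  rewrite Rpower_pow by now apply Rabs_pos_lt. apply pow2_abs.
Qed.

Lemma abs_pow_le (q x b : R) :
  0 <= q -> Rabs x <= b -> 0 < b -> abs_pow q x <= Rpower b q.
Proof.
  intros Hq Hx Hb. unfold abs_pow. destruct (Req_dec_T x 0).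
  - apply Rlt_le, exp_pos.
  - apply Rle_Rpower_l; [lra|]. split; [now apply Rabs_pos_lt|exact Hx].
Qed.

(** Splitting 2 = (1-p) + (1+p) gives x^2 = |x|^(1-p) P. Bounds on |w| enter the energy estimates
    through this factor. *)
Lemma sqr_le_abs_pow (p x b : R) :
  p < 1 -> Rabs x <= b -> 0 < b -> x ^ 2 <= Rpower b (1 - p) * abs_pow (1 + p) x.
Proof.
  intros Hp Hx Hb. rewrite <- abs_pow_2.
  replace 2 with ((1 - p) + (1 + p)) by ring. rewrite abs_pow_add.
  apply Rmult_le_compat_r; [apply abs_pow_ge0|]. apply abs_pow_le; lra.
Qed.

Lemma mult_H (p x : R) : x * H p x = x ^ 2 / (1 - p) - abs_pow (1 + p) x.
Proof.
  unfold H, abs_pow. destruct (Req_dec_T x 0) as [->|Hx].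
  - unfold Rdiv. ring.
  - replace (1 + p) with (INR 2 + (p - 1)) by (simpl; ring).
    rewrite Rpower_plus, Rpower_pow by now apply Rabs_pos_lt.
    rewrite pow2_abs. unfold Rdiv. ring.
Qed.

(** At 0 the difference quotient has modulus |h|^p, which is below e once |h| < e^(1/p). Elsewhere
    the function is locally an ordinary power of |y|. *)
Lemma is_derive_abs_pow (p x : R) : 0 < p ->
  is_derive (abs_pow (1 + p)) x
    ((1 + p) * (if Req_dec_T x 0 then 0 else x * Rpower (Rabs x) (p - 1))).
Proof.
  intros Hp. destruct (Req_dec_T x 0) as [->|Hx].
  - rewrite Rmult_0_r. apply is_derive_Reals.
    intros e He. exists (mkposreal (Rpower e (1 / p)) (exp_pos _)).
    intros h Hh0 Hh. simpl in Hh.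
    rewrite Rplus_0_l, Rminus_0_r.
    assert (Hh' : 0 < Rabs h) by now apply Rabs_pos_lt.
    unfold abs_pow. destruct (Req_dec_T h 0) as [|_]; [easy|].
    destruct (Req_dec_T 0 0) as [_|]; [|easy].
    rewrite Rminus_0_r, Rpower_plus, Rpower_1 by exact Hh'.
    unfold Rdiv. rewrite !Rabs_mult, Rabs_Rabsolu, Rabs_inv.
    rewrite (Rabs_pos_eq (Rpower _ _)) by apply Rlt_le, exp_pos.
    replace (Rabs h * Rpower (Rabs h) p * / Rabs h) with (Rpower (Rabs h) p)
      by (field; lra).
    replace e with (Rpower (Rpower e (1 / p)) p).
    + apply Rlt_Rpower_l; lra.
    + apply Rpower_root; lra.
  - apply (is_derive_ext_loc (fun y => Rpower (Rabs y) (1 + p))).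
    + assert (Hr : 0 < Rabs x) by now apply Rabs_pos_lt.
      exists (mkposreal _ Hr). intros y Hy.
      unfold abs_pow. destruct (Req_dec_T y 0) as [->|]; [|reflexivity].
      exfalso. change (Rabs (0 - x) < Rabs x) in Hy.
      rewrite Rminus_0_l, Rabs_Ropp in Hy. lra.
    + unfold Rpower. auto_derive.
      * repeat split; [exact Hx|now apply Rabs_pos_lt].
      * assert (Hr : 0 < Rabs x) by now apply Rabs_pos_lt.
        replace ((1 + p) * ln (Rabs x)) with (2 * ln (Rabs x) + (p - 1) * ln (Rabs x)) by ring.
        rewrite exp_plus. change (exp (2 * ln (Rabs x))) with (Rpower (Rabs x) (INR 2)).
        rewrite Rpower_pow by exact Hr. simpl.
        assert (Hs : sign x * Rabs x = x).
        { destruct (Rlt_dec 0 x).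
          - rewrite sign_eq_1, Rabs_pos_eq; lra.
          - rewrite sign_eq_m1, Rabs_left; lra. }
        transitivity ((1 + p) * (sign x * Rabs x) * exp ((p - 1) * ln (Rabs x))).
        -- field. lra.
        -- rewrite Hs. ring.
Qed.

Lemma is_derive_potential (p x : R) : 0 < p < 1 ->
  is_derive (potential p) x (- H p x).
Proof.
  intros Hp. pose proof (is_derive_abs_pow p x (proj1 Hp)) as D.
  unfold potential.
  replace (- H p x) with
    (/ (1 + p) * ((1 + p) * (if Req_dec_T x 0 then 0 else x * Rpower (Rabs x) (p - 1)))
     - 2 * x / (2 * (1 - p))).
  2:{ unfold H. destruct (Req_dec_T x 0) as [->|]; field; lra. }
  apply (is_derive_minus (fun y => abs_pow (1 + p) y / (1 + p))
           (fun y => y ^ 2 / (2 * (1 - p)))).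
  - apply (is_derive_ext (fun y => / (1 + p) * abs_pow (1 + p) y)).
    + intros t. unfold Rdiv. simpl. apply Rmult_comm.
    + now apply is_derive_scal.
  - auto_derive; [easy|]. field. lra.
Qed.

(** By the mean value theorem it suffices that H(c) < 0 below the equilibrium. There c^(1-p) < 1-p,
    so c^2/(1-p) < P and c H(c) < 0. *)
Lemma potential_lt (p a b : R) : 0 < p < 1 ->
  0 < a < b -> b < Rpower (1 - p) (1 / (1 - p)) -> potential p a < potential p b.
Proof.
  intros Hp Hab Hb.
  destruct (MVT_gen (potential p) a b (fun x => - H p x)) as (c & Hc & E).
  - intros x _. now apply is_derive_potential.
  - intros x _. apply derivable_continuous_pt.
    exists (- H p x). apply is_derive_Reals. now apply is_derive_potential.
  - rewrite Rmin_left, Rmax_right in Hc by lra.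
    pose proof (mult_H p c) as HH.
    assert (Hlt : Rpower c (1 - p) < 1 - p).
    { replace (1 - p) with (Rpower (Rpower (1 - p) (1 / (1 - p))) (1 - p)) at 2.
      - apply Rlt_Rpower_l; lra.
      - apply Rpower_root; lra. }
    assert (Hsq := sqr_le_abs_pow p c c ltac:(lra) ltac:(rewrite Rabs_pos_eq; lra) ltac:(lra)).
    assert (HP : 0 < abs_pow (1 + p) c).
    { unfold abs_pow. destruct (Req_dec_T c 0); [lra|apply exp_pos]. }
    assert (c ^ 2 / (1 - p) < abs_pow (1 + p) c).
    { apply Rmult_lt_reg_r with (1 - p); [lra|].
      replace (c ^ 2 / (1 - p) * (1 - p)) with (c ^ 2) by (field; lra). nra. }
    nra.
Qed.

(** The quadratic term costs at most P/2, and 1/(1+p) - 1/2 is the constant on the left. *)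
Lemma potential_ge (p x b : R) : 0 < p < 1 ->
  b <= 1 - p -> x ^ 2 <= b * abs_pow (1 + p) x ->
  (1 - p) / (2 * (1 + p)) * abs_pow (1 + p) x <= potential p x.
Proof.
  intros Hp Hb Hx. unfold potential. pose proof (abs_pow_ge0 (1 + p) x) as HP.
  set (P := abs_pow (1 + p) x) in *.
  assert (x ^ 2 / (2 * (1 - p)) <= P / 2).
  { apply Rmult_le_reg_r with (2 * (1 - p)); [lra|].
    replace (x ^ 2 / (2 * (1 - p)) * (2 * (1 - p))) with (x ^ 2) by (field; lra). nra. }
  replace ((1 - p) / (2 * (1 + p)) * P) with (P / (1 + p) - P / 2) by (field; lra).
  lra.
Qed.

(** * Pointwise inequalities for the modified energy *)

(** The left side is F' with w = x, h = H(w) and v' = h - (m/t + t/2) v. After multiplication by t,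
    damping supplies -(t^2/2) v^2 and the term K x h supplies -K c P; half of each pays for the
    cross terms. *)
Lemma modified_energy_dissipation (m K c b t x v h P U : R) :
  0 <= m -> 0 < K -> 0 < c <= 1 -> 0 < t ->
  2 * (m + 1) <= t ^ 2 -> 8 * K <= t ^ 2 -> K ^ 2 * b <= 2 * t ^ 2 ->
  K * b <= c / 2 -> 0 <= P -> x ^ 2 <= b * P -> x * h <= - c * P -> U <= P ->
  - (m / t + t / 2) * v ^ 2 + K / t * (v ^ 2 + x * (h - (m / t + t / 2) * v))
    - K / t ^ 2 * (x * v)
  <= - (K * c / 4) / t * (v ^ 2 / 2 + U + K / t * (x * v)).
Proof.
  intros Hm HK Hc Ht H1 H2 H3 H4 HP Hx Hh HU.
  (* All cross terms together have coefficient -K d with d <= t, since m + 1 <= t^2/2. Expanding (d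
     v/2 + K x)^2 >= 0 separates x from v, and K b <= c/2 bounds K^2 x^2. *)
  assert (Hcross : - (K * (m / t + t / 2 + 1 / t)) * (x * v)
                   <= t ^ 2 / 4 * v ^ 2 + K * c / 2 * P).
  { set (d := m / t + t / 2 + 1 / t).
    assert (Hd : 0 <= d <= t).
    { assert (E : d = (m + 1 + t ^ 2 / 2) * / t) by (unfold d; field; lra).
      pose proof (Rinv_0_lt_compat t Ht) as Hi. split; [rewrite E; nra|].
      apply Rmult_le_reg_r with t; [exact Ht|].
      rewrite E, Rmult_assoc, Rinv_l by lra. nra. }
    assert (d ^ 2 <= t ^ 2) by nra.
    assert (d ^ 2 * v ^ 2 <= t ^ 2 * v ^ 2) by (apply Rmult_le_compat_r; nra).
    assert (K ^ 2 * x ^ 2 <= K * c / 2 * P).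
    { apply Rle_trans with (K * (K * b) * P); [|apply Rmult_le_compat_r; nra].
      replace (K * (K * b) * P) with (K ^ 2 * (b * P)) by ring.
      apply Rmult_le_compat_l; nra. }
    assert (0 <= (d * v / 2 + K * x) ^ 2) by apply pow2_ge_0.
    nra. }
  assert (Hup : v ^ 2 / 2 + U + K / t * (x * v) <= v ^ 2 + 2 * P).
  { assert (0 <= (v - K / t * x) ^ 2) by apply pow2_ge_0.
    assert ((K / t) ^ 2 * x ^ 2 <= 2 * P).
    { apply Rmult_le_reg_r with (t ^ 2); [nra|].
      replace ((K / t) ^ 2 * x ^ 2 * t ^ 2) with (K ^ 2 * x ^ 2) by (field; lra).
      apply Rle_trans with (K ^ 2 * (b * P)); nra. }
    nra. }
  apply Rmult_le_reg_r with t; [exact Ht|].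
  replace (- (K * c / 4) / t * (v ^ 2 / 2 + U + K / t * (x * v)) * t)
    with (- (K * c / 4) * (v ^ 2 / 2 + U + K / t * (x * v))) by (field; lra).
  replace ((- (m / t + t / 2) * v ^ 2 + K / t * (v ^ 2 + x * (h - (m / t + t / 2) * v))
    - K / t ^ 2 * (x * v)) * t)
    with (- (m + t ^ 2 / 2) * v ^ 2 + K * v ^ 2 + K * (x * h)
          + - (K * (m / t + t / 2 + 1 / t)) * (x * v)) by (field; lra).
  assert (K * (x * h) <= K * (- c * P)) by (apply Rmult_le_compat_l; lra).
  assert (K * c / 4 * (v ^ 2 / 2 + U + K / t * (x * v)) <= K * c / 4 * (v ^ 2 + 2 * P))
    by (apply Rmult_le_compat_l; nra).
  assert (0 <= v ^ 2) by apply pow2_ge_0.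
  assert (8 * K * v ^ 2 <= t ^ 2 * v ^ 2) by (apply Rmult_le_compat_r; lra).
  assert (0 <= m * v ^ 2) by nra.
  assert (K * c * v ^ 2 <= K * v ^ 2) by (apply Rmult_le_compat_r; nra).
  nra.
Qed.

(** Completing a square, the cross term takes at most half of the kinetic and half of the potential
    part; so decay of F passes to v^2 and P. *)
Lemma modified_energy_bounds (K b t x v P U u : R) :
  0 < K -> 0 < t -> 0 <= P -> x ^ 2 <= b * P ->
  u * P <= U -> 2 * (K ^ 2 * b) <= u * t ^ 2 ->
  v ^ 2 / 4 + u / 2 * P <= v ^ 2 / 2 + U + K / t * (x * v).
Proof.
  intros HK Ht HP Hx HU Hu.
  assert (0 <= (v / 2 + K / t * x) ^ 2) by apply pow2_ge_0.
  assert ((K / t) ^ 2 * x ^ 2 <= u / 2 * P).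
  { apply Rmult_le_reg_r with (t ^ 2); [nra|].
    replace ((K / t) ^ 2 * x ^ 2 * t ^ 2) with (K ^ 2 * x ^ 2) by (field; lra).
    apply Rle_trans with (K ^ 2 * (b * P)); nra. }
  nra.
Qed.

(** * Decay of the modified energy along a solution *)

Lemma nonincreasing_of_derive (f df : R -> R) (a b : R) :
  a <= b -> (forall x, a <= x <= b -> is_derive f x (df x)) ->
  (forall x, a <= x <= b -> df x <= 0) -> f b <= f a.
Proof.
  intros Hab Hd Hneg.
  destruct (MVT_gen f a b df) as (c & Hc & E).
  - rewrite Rmin_left, Rmax_right by lra. intros x Hx. apply Hd. lra.
  - rewrite Rmin_left, Rmax_right by lra. intros x Hx. apply derivable_continuous_pt.
    exists (df x). apply is_derive_Reals, Hd. lra.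
  - rewrite Rmin_left, Rmax_right in Hc by lra. specialize (Hneg c Hc). nra.
Qed.

(** The first bound on b yields w H(w) <= -c P; the condition K b <= c/2 lets the rate K c/4 grow as
    b shrinks. Both passes of the argument are instances. *)
Lemma polynomial_decay (p m K c b T0 : R) (w v : R -> R) :
  0 < p < 1 -> 0 <= m -> 0 < K -> 0 < c <= 1 -> 0 < b ->
  b <= (1 - c) * (1 - p) -> K * b <= c / 2 ->
  (forall t, 0 < t -> is_derive w t (v t)) ->
  (forall t, 0 < t -> is_derive v t (H p (w t) - (m / t + t / 2) * v t)) ->
  (forall t, T0 <= t -> w t ^ 2 <= b * abs_pow (1 + p) (w t)) ->
  exists T C, 1 <= T /\ 0 <= C /\ forall t, T <= t ->
    w t ^ 2 <= C * Rpower t (- (K * c / 4)) /\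
    v t ^ 2 <= C * Rpower t (- (K * c / 4)).
Proof.
  intros Hp Hm HK Hc Hb0 Hb HKb Dw Dv Hw.
  set (u := (1 - p) / (2 * (1 + p))).
  assert (Hu : 0 < u) by (apply Rdiv_lt_0_compat; lra).
  set (k := K * c / 4).
  set (B := K ^ 2 * b).
  assert (B_pos : 0 < B) by (apply Rmult_lt_0_compat; [apply pow_lt|]; lra).
  (* A sum of nonnegative terms exceeds each largeness threshold; since t >= 1 gives t <= t^2, the
     thresholds pass to t^2. *)
  set (T := 1 + Rabs T0 + 2 * (m + 1) + 8 * K + B + 2 * (B / u)).
  assert (HBu : 0 < B / u) by now apply Rdiv_lt_0_compat.
  assert (HT0 := Rle_abs T0). assert (HT0' := Rabs_pos T0).
  assert (HT : 1 <= T) by (unfold T; lra).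
  set (F := fun t => v t ^ 2 / 2 + potential p (w t) + K / t * (w t * v t)).
  assert (Hpt : forall t, T <= t -> 0 < t /\ T0 <= t /\ 2 * (m + 1) <= t ^ 2 /\ 8 * K <= t ^ 2 /\ B <= 2 * t ^ 2 /\ 2 * B <= u * t ^ 2).
  { intros t Ht. assert (t <= t ^ 2) by nra. unfold T in Ht.
    repeat split; try lra.
    replace (2 * B) with (u * (2 * (B / u))) by (field; lra).
    apply Rmult_le_compat_l; lra. }
  assert (Hlow : forall t, T <= t ->
    v t ^ 2 / 4 + u / 2 * abs_pow (1 + p) (w t) <= F t).
  { intros t Ht. destruct (Hpt t Ht) as (H0 & H1 & _ & _ & _ & H5).
    apply modified_energy_bounds with b; auto using abs_pow_ge0.
    apply potential_ge with b; auto. nra. }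
  set (dF := fun t => - (m / t + t / 2) * v t ^ 2 + K / t * (v t ^ 2 + w t *
    (H p (w t) - (m / t + t / 2) * v t)) - K / t ^ 2 * (w t * v t)).
  assert (DF : forall t, 0 < t -> is_derive F t (dF t)).
  { intros t Ht. unfold F. pose proof (is_derive_potential p (w t) Hp) as DU.
    specialize (Dw t Ht). specialize (Dv t Ht).
    set (U := potential p) in *. auto_derive.
    - repeat split; try lra; eexists; eassumption.
    - apply is_derive_unique in Dw, Dv, DU.
      change (Derive (fun x => w x) t) with (Derive w t).
      change (Derive (fun x => v x) t) with (Derive v t).
      change (Derive (fun x => U x) (w t)) with (Derive U (w t)).
      rewrite Dw, Dv, DU.
      unfold dF. field. lra. }
  assert (DFneg : forall t, T <= t -> dF t <= - k / t * F t).
  { intros t Ht. destruct (Hpt t Ht) as (H0 & H1 & H2 & H3 & H4 & _).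
    apply modified_energy_dissipation with (b := b) (P := abs_pow (1 + p) (w t));
      auto using abs_pow_ge0.
    - rewrite mult_H. specialize (Hw t H1). pose proof (abs_pow_ge0 (1 + p) (w t)).
      apply Rmult_le_reg_r with (1 - p); [lra|].
      replace ((w t ^ 2 / (1 - p) - abs_pow (1 + p) (w t)) * (1 - p))
        with (w t ^ 2 - abs_pow (1 + p) (w t) * (1 - p)) by (field; lra).
      nra.
    - unfold potential. pose proof (abs_pow_ge0 (1 + p) (w t)).
      assert (0 <= w t ^ 2 / (2 * (1 - p)))
        by (apply Rdiv_le_0_compat; [apply pow2_ge_0|lra]).
      assert (abs_pow (1 + p) (w t) / (1 + p) <= abs_pow (1 + p) (w t)); [|lra].
      apply Rmult_le_reg_r with (1 + p); [lra|].
      replace (abs_pow (1 + p) (w t) / (1 + p) * (1 + p))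
        with (abs_pow (1 + p) (w t)) by (field; lra). nra. }
  (* The integrating factor t^k turns F' <= -(k/t) F into monotonicity of F t^k. *)
  assert (HF : forall t, T <= t -> F t * Rpower t k <= F T * Rpower T k).
  { intros t Ht.
    apply (nonincreasing_of_derive (fun s => F s * Rpower s k)
      (fun s => (dF s + k / s * F s) * Rpower s k)); [exact Ht| |].
    - intros s Hs. specialize (DF s ltac:(lra)). unfold Rpower. auto_derive.
      + repeat split; [eexists; eassumption|lra].
      + apply is_derive_unique in DF.
        change (Derive (fun x => F x) s) with (Derive F s). rewrite DF. field. lra.
    - intros s Hs. specialize (DFneg s ltac:(lra)).
      assert (0 < Rpower s k) by apply exp_pos.
      assert (dF s + k / s * F s <= 0).
      { replace (- k / s * F s) with (- (k / s * F s)) in DFneg by (field; lra). lra. }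
      nra. }
  set (C0 := F T * Rpower T k) in *.
  assert (HC0 : 0 <= C0).
  { unfold C0. apply Rmult_le_pos; [|apply Rlt_le, exp_pos].
    specialize (Hlow T ltac:(lra)). pose proof (abs_pow_ge0 (1 + p) (w T)). nra. }
  assert (HF' : forall t, T <= t -> F t <= C0 * Rpower t (- k)).
  { intros t Ht. specialize (HF t Ht).
    rewrite Rpower_Ropp. apply Rmult_le_reg_r with (Rpower t k); [apply exp_pos|].
    rewrite Rmult_assoc, Rinv_l, Rmult_1_r; [exact HF|].
    apply Rgt_not_eq, exp_pos. }
  (* The lower bound on F gives v^2 <= 4 F and w^2 <= b P <= (2 b/u) F. *)
  exists T, (C0 * (4 + 2 * (b / u))).
  assert (Hbu : 0 < b / u) by now apply Rdiv_lt_0_compat.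
  split; [exact HT|]. split; [nra|].
  intros t Ht. specialize (HF' t Ht). specialize (Hlow t Ht).
  assert (Hq : 0 < Rpower t (- k)) by apply exp_pos.
  pose proof (abs_pow_ge0 (1 + p) (w t)) as HP.
  assert (HX : 0 <= C0 * Rpower t (- k)) by nra.
  replace (C0 * (4 + 2 * (b / u)) * Rpower t (- k))
    with (C0 * Rpower t (- k) * (4 + 2 * (b / u))) by ring.
  set (X := C0 * Rpower t (- k)) in *.
  assert (0 <= v t ^ 2) by apply pow2_ge_0.
  split.
  - apply Rle_trans with (b * abs_pow (1 + p) (w t)).
    + apply Hw. now destruct (Hpt t Ht).
    + replace (b * abs_pow (1 + p) (w t))
        with (2 * (b / u) * (u / 2 * abs_pow (1 + p) (w t))) by (field; lra).
      assert (u / 2 * abs_pow (1 + p) (w t) <= X) by lra.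
      nra.
  - assert (0 <= u / 2 * abs_pow (1 + p) (w t)) by nra. nra.
Qed.

(** * One-sided regularity at 0, energy monotonicity and confinement *)

Lemma potential_abs (p x : R) : potential p (Rabs x) = potential p x.
Proof. unfold potential. rewrite abs_pow_abs, pow2_abs. reflexivity. Qed.

(** Increments shorter than x stay inside the half-line, so the relative derivative is a two-sided
    one. *)
Lemma D_in_interior (f f1 : R -> R) (x : R) :
  0 < x -> D_in f f1 (fun y => 0 <= y) x -> is_derive f x (f1 x).
Proof.
  intros Hx Hf. apply is_derive_Reals. intros e He.
  destruct (Hf e He) as (d & Hd & Hlim). simpl in Hlim. unfold Rdist in Hlim.
  assert (Hm : 0 < Rmin d x) by (apply Rmin_glb_lt; lra).
  exists (mkposreal _ Hm). intros h Hh0 Hh. simpl in Hh.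
  pose proof (Rmin_l d x). pose proof (Rmin_r d x).
  assert (Hlow := Rabs_def2 _ _ Hh).
  specialize (Hlim (x + h)). replace (x + h - x) with h in Hlim by ring.
  apply Hlim. unfold D_x. repeat split; lra.
Qed.

(** Precomposition with the 1-Lipschitz retraction onto the half-line; the mean and intermediate
    value theorems can then be applied on intervals starting at 0. *)
Lemma continuous_extension (f : R -> R) :
  (forall x, 0 <= x -> continue_in f (fun y => 0 <= y) x) ->
  continuity (fun y => f (Rmax 0 y)).
Proof.
  intros Hf x e He. destruct (Hf (Rmax 0 x) (Rmax_l 0 x) e He) as (d & Hd & Hlim).
  simpl in *. unfold Rdist in *. exists d. split; [exact Hd|].
  (* The relative limit excludes the base point, but distinct points may retract to the same one. *)
  intros y [_ Hy]. destruct (Req_dec (Rmax 0 x) (Rmax 0 y)) as [->|Hne].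
  - now rewrite Rminus_diag, Rabs_R0.
  - apply Hlim. split; [split; [apply Rmax_l|exact Hne]|].
    apply Rle_lt_trans with (2 := Hy).
    unfold Rmax, Rabs. repeat destruct Rle_dec; repeat destruct Rcase_abs; lra.
Qed.

Lemma continuity_potential (p : R) : 0 < p < 1 -> continuity (potential p).
Proof.
  intros Hp x. apply derivable_continuous_pt.
  exists (- H p x). apply is_derive_Reals. now apply is_derive_potential.
Qed.

(** The energy has derivative -(m/t + t/2) v^2 for t > 0. At the singular point t = 0 only
    continuity enters. *)
Lemma energy_le_initial (p m : R) (w v : R -> R) :
  0 < p < 1 -> 0 <= m ->
  (forall t, 0 <= t -> continue_in w (fun y => 0 <= y) t) ->
  (forall t, 0 <= t -> continue_in v (fun y => 0 <= y) t) ->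
  (forall t, 0 < t -> is_derive w t (v t)) ->
  (forall t, 0 < t -> is_derive v t (H p (w t) - (m / t + t / 2) * v t)) ->
  forall t, 0 <= t ->
    v t ^ 2 / 2 + potential p (w t) <= v 0 ^ 2 / 2 + potential p (w 0).
Proof.
  intros Hp Hm Cw Cv Dw Dv t Ht.
  pose proof (continuous_extension w Cw) as Cw'.
  pose proof (continuous_extension v Cv) as Cv'.
  pose (E := fun s => / 2 * (v (Rmax 0 s) * v (Rmax 0 s)) + potential p (w (Rmax 0 s))).
  destruct (MVT_gen E 0 t (fun s => - (m / s + s / 2) * v s ^ 2)) as (s & Hs & HE).
  - rewrite Rmin_left, Rmax_right by lra. intros s Hs.
    apply (is_derive_ext_loc (fun s => / 2 * (v s * v s) + potential p (w s))).
    + exists (mkposreal s (proj1 Hs)). intros y Hy.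
      assert (Hy' := Rabs_def2 _ _ Hy). unfold E, minus, plus, opp in *; simpl in *.
      now rewrite Rmax_right by lra.
    + pose proof (is_derive_potential p (w s) Hp) as DU.
      specialize (Dw s (proj1 Hs)). specialize (Dv s (proj1 Hs)).
      set (U := potential p) in *. auto_derive.
      * repeat split; eexists; eassumption.
      * apply is_derive_unique in Dw, Dv, DU.
        change (Derive (fun x => w x) s) with (Derive w s).
        change (Derive (fun x => v x) s) with (Derive v s).
        change (Derive (fun x => U x) (w s)) with (Derive U (w s)).
        rewrite Dw, Dv, DU. field. lra.
  - intros s _. apply continuity_pt_plus.
    + apply continuity_pt_scal. now apply continuity_pt_mult.
    + apply (continuity_pt_comp (fun s => w (Rmax 0 s)) (potential p)); [apply Cw'|].
      now apply continuity_potential.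
  - rewrite Rmin_left, Rmax_right in Hs by lra.
    unfold E in HE. rewrite (Rmax_right 0 t), (Rmax_left 0 0) in HE by lra.
    assert (0 <= m / s + s / 2).
    (* The mean value point ranges over the closed interval; at s = 0 the convention [/ 0 = 0] gives
       the sign. *)
    { destruct (Req_dec s 0) as [->|Hs0].
      - unfold Rdiv. rewrite Rinv_0. lra.
      - assert (0 <= m / s) by (apply Rdiv_le_0_compat; lra). lra. }
    assert (0 <= (m / s + s / 2) * v s ^ 2)
      by (apply Rmult_le_pos; [assumption|apply pow2_ge_0]).
    nra.
Qed.

(* The potential is a barrier: it increases strictly from [Rabs (w 0)] up to
   the equilibrium, and a solution at rest initially cannot climb it. *)
Lemma confinement (p m : R) (w v : R -> R) :
  0 < p < 1 -> 0 <= m ->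
  (forall t, 0 <= t -> continue_in w (fun y => 0 <= y) t) ->
  (forall t, 0 <= t -> continue_in v (fun y => 0 <= y) t) ->
  (forall t, 0 < t -> is_derive w t (v t)) ->
  (forall t, 0 < t -> is_derive v t (H p (w t) - (m / t + t / 2) * v t)) ->
  0 < w 0 < Rpower (1 - p) (1 / (1 - p)) -> v 0 = 0 ->
  forall t, 0 <= t -> Rabs (w t) <= w 0.
Proof.
  intros Hp Hm Cw Cv Dw Dv Hw0 Hv0 t Ht.
  destruct (Rle_dec (Rabs (w t)) (w 0)) as [|Hgt]; [assumption|exfalso].
  set (A := Rpower (1 - p) (1 / (1 - p))) in *.
  (* A level strictly between w(0) and the equilibrium that |w| must attain if it ever exceeds
     w(0). *)
  set (b := Rmin (Rabs (w t)) ((w 0 + A) / 2)).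
  assert (Hb1 : b <= Rabs (w t)) by apply Rmin_l.
  assert (Hb2 : b <= (w 0 + A) / 2) by apply Rmin_r.
  assert (Hb0 : w 0 < b) by (apply Rmin_glb_lt; lra).
  destruct (IVT_gen (fun s => Rabs (w (Rmax 0 s))) 0 t b) as (s & Hs & Es).
  - intros x. apply (continuity_pt_comp (fun s => w (Rmax 0 s)) Rabs).
    + now apply continuous_extension.
    + apply Rcontinuity_abs.
  - rewrite (Rmax_left 0 0), (Rmax_right 0 t), (Rabs_pos_eq (w 0)) by lra.
    rewrite Rmin_left, Rmax_right by lra. lra.
  - rewrite Rmin_left, Rmax_right in Hs by lra.
    rewrite Rmax_right in Es by lra.
    pose proof (energy_le_initial p m w v Hp Hm Cw Cv Dw Dv s (proj1 Hs)) as HE.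
    rewrite <- (potential_abs p (w s)), Es, Hv0 in HE.
    pose proof (potential_lt p (w 0) b Hp ltac:(lra) ltac:(fold A; lra)).
    pose proof (pow2_ge_0 (v s)). lra.
Qed.

(** * From decay at infinity to bounds on the whole half-line *)

Lemma Rpower_neg_small (C k e : R) : 0 <= C -> 0 < k -> 0 < e ->
  exists T, 0 < T /\ forall t, T <= t -> C * Rpower t (- k) <= e.
Proof.
  intros HC Hk He.
  assert (Hq : 0 <= C / e) by now apply Rdiv_le_0_compat.
  (* The summand 1 keeps the base positive when C = 0. *)
  exists (Rpower (C / e + 1) (1 / k)). split; [apply exp_pos|]. intros t Ht.
  assert (Hle : C / e + 1 <= Rpower t k).
  { replace (C / e + 1) with (Rpower (Rpower (C / e + 1) (1 / k)) k).
    - apply Rle_Rpower_l; [lra|]. split; [apply exp_pos|exact Ht].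
    - apply Rpower_root; lra. }
  rewrite Rpower_Ropp. apply Rmult_le_reg_r with (Rpower t k); [lra|].
  rewrite Rmult_assoc, Rinv_l, Rmult_1_r by lra.
  replace C with (e * (C / e)) by (field; lra). apply Rmult_le_compat_l; lra.
Qed.

(** On (0, T] the weight gives |f| t^a <= L t^(j+a), bounded as j+a >= 0; beyond T >= 1 the decay of
    f^2 gives (|f| t^a)^2 <= C as a <= k. *)
Lemma superpower_bound (f : R -> R) (L j T C k a : R) :
  0 <= L -> 1 <= T -> 0 <= C -> 0 <= j + a -> a <= k ->
  (forall t, 0 < t -> Rabs (f t) <= L * Rpower t j) ->
  (forall t, T <= t -> f t ^ 2 <= C * Rpower t (- (2 * k))) ->
  exists c, 0 < c /\ forall t, 0 < t -> Rabs (f t) < c / Rpower t a.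
Proof.
  intros HL HT HC Hja Hak Hsmall Hlarge.
  assert (HTja : 0 <= L * Rpower T (j + a))
    by (apply Rmult_le_pos; [lra|apply Rlt_le, exp_pos]).
  (* C + 2 strictly exceeds every y with y^2 <= C. *)
  exists (L * Rpower T (j + a) + C + 2). split; [lra|]. intros t Ht.
  assert (Hta : 0 < Rpower t a) by apply exp_pos.
  apply Rmult_lt_reg_r with (Rpower t a); [exact Hta|].
  unfold Rdiv. rewrite Rmult_assoc, Rinv_l, Rmult_1_r by lra.
  destruct (Rle_dec t T) as [HtT|HtT].
  - apply Rle_lt_trans with (L * Rpower T (j + a)); [|lra].
    apply Rle_trans with (L * Rpower t j * Rpower t a).
    + apply Rmult_le_compat_r; [lra|now apply Hsmall].
    + rewrite Rmult_assoc, <- Rpower_plus. apply Rmult_le_compat_l; [lra|].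
      apply Rle_Rpower_l; lra.
  - assert (Hsq : (Rabs (f t) * Rpower t a) ^ 2 <= C).
    { rewrite Rpow_mult_distr, pow2_abs.
      apply Rle_trans with (C * Rpower t (- (2 * k)) * Rpower t a ^ 2).
      - apply Rmult_le_compat_r; [apply pow2_ge_0|]. apply Hlarge. lra.
      - replace (Rpower t a ^ 2) with (Rpower t (a + a)) by (rewrite Rpower_plus; ring).
        rewrite Rmult_assoc, <- Rpower_plus.
        rewrite <- (Rmult_1_r C) at 2. apply Rmult_le_compat_l; [lra|].
        rewrite <- (Rpower_O t) by lra. apply Rle_Rpower; lra. }
    nra.
Qed.

(** Near 0 the quotient v/t is within 1 of v'(0); for t >= d, M <= (M/d) t. The weight on w' may
    have an exponent as low as -1, so boundedness of v near 0 would not suffice. *)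
Lemma linear_bound_at_zero (v v' : R -> R) (M : R) :
  v 0 = 0 -> D_in v v' (fun y => 0 <= y) 0 ->
  (forall t, 0 <= t -> Rabs (v t) <= M) ->
  exists L, 0 <= L /\ forall t, 0 < t -> Rabs (v t) <= L * t.
Proof.
  intros Hv0 Hd HM.
  destruct (Hd 1 Rlt_0_1) as (d & Hd0 & Hlim). simpl in Hlim. unfold Rdist in Hlim.
  assert (HM0 : 0 <= M) by (apply Rle_trans with (2 := HM 0 (Rle_refl 0)); apply Rabs_pos).
  assert (HMd : 0 <= M / d) by now apply Rdiv_le_0_compat.
  pose proof (Rabs_pos (v' 0)) as Hv'.
  exists (Rabs (v' 0) + 1 + M / d). split; [lra|]. intros t Ht.
  destruct (Rlt_dec t d) as [Htd|Htd].
  - specialize (Hlim t). rewrite Hv0, !Rminus_0_r, (Rabs_pos_eq t) in Hlim by lra.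
    specialize (Hlim ltac:(unfold D_x; repeat split; lra)).
    apply Rle_trans with ((Rabs (v' 0) + 1) * t); [|nra].
    replace (v t) with ((v t / t - v' 0 + v' 0) * t) by (field; lra).
    rewrite Rabs_mult, (Rabs_pos_eq t) by lra. apply Rmult_le_compat_r; [lra|].
    apply Rle_trans with (1 := Rabs_triang _ _). lra.
  - apply Rle_trans with M; [apply HM; lra|].
    apply Rle_trans with (M / d * t); [|nra].
    replace M with (M / d * d) at 1 by (field; lra). apply Rmult_le_compat_l; lra.
Qed.

(* The upper bound on eps is the natural range of the loss eps: for
   eps > 2/(1-p) both right-hand sides are too small as eta -> 0, where
   w(eta) -> alpha > 0 and w'(eta)/eta -> H(alpha)/n < 0. *)
Theorem theorem4p3 (n : nat) (hn : (1 <= n)%nat) (p : R) (hp : 0 < p < 1)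
  (alpha : R) (halpha : 0 < alpha < Rpower (1 - p) (1 / (1 - p)))
  (w : R -> R) (hw : solution n p alpha w)
  (eps : R) (heps : 0 < eps <= 2 / (1 - p)) :
  exists c1 c2 : R, 0 < c1 /\ 0 < c2 /\
    (forall eta, 0 < eta ->
      Rabs (w eta) < c1 / Rpower eta (2 / (1 - p) - eps)) /\
    (forall eta, 0 < eta ->
      Rabs (Derive w eta) < c2 / Rpower eta ((1 + p) / (1 - p) - eps)).
Proof.
  destruct hw as (v & w2 & HC2 & _ & Hw0 & Hv0 & Hode).
  assert (Hm : 0 <= INR n - 1) by (apply le_INR in hn; simpl in hn; lra).
  set (m := INR n - 1) in *.
  assert (Cw : forall t, 0 <= t -> continue_in w (fun y => 0 <= y) t)
    by (intros t Ht; apply cont_deriv with v; now apply HC2).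
  assert (Cv : forall t, 0 <= t -> continue_in v (fun y => 0 <= y) t)
    by (intros t Ht; apply cont_deriv with w2; now apply HC2).
  assert (Dw : forall t, 0 < t -> is_derive w t (v t))
    by (intros t Ht; apply D_in_interior; [|apply HC2]; lra).
  assert (Dv : forall t, 0 < t -> is_derive v t (H p (w t) - (m / t + t / 2) * v t)).
  { intros t Ht. replace (H p (w t) - (m / t + t / 2) * v t) with (w2 t)
      by (specialize (Hode t Ht); lra).
    apply D_in_interior; [|apply HC2]; lra. }
  rewrite <- Hw0 in halpha.
  assert (Hconf := confinement p m w v hp Hm Cw Cv Dw Dv halpha Hv0).
  set (b0 := Rpower (w 0) (1 - p)).
  assert (Hb0 : 0 < b0) by apply exp_pos.
  assert (Hb0' : b0 < 1 - p).
  { replace (1 - p) with (Rpower (Rpower (1 - p) (1 / (1 - p))) (1 - p)).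
    - apply Rlt_Rpower_l; lra.
    - apply Rpower_root; lra. }
  assert (Hsq : forall t, 0 <= t -> w t ^ 2 <= b0 * abs_pow (1 + p) (w t))
    by (intros t Ht; apply sqr_le_abs_pow; [|apply Hconf|]; lra).
  (* The relative gap between confinement and equilibrium; it is positive because w(0) lies strictly
     below the latter. *)
  set (c := 1 - b0 / (1 - p)).
  assert (Ec : b0 = (1 - c) * (1 - p)) by (unfold c; field; lra).
  assert (Hc : 0 < c <= 1) by nra.
  assert (Hsmall : forall e, 0 < e -> exists T, 0 < T /\ forall t, T <= t -> Rabs (w t) <= e).
  (* First pass, with the largest K that satisfies K b0 <= c/2. *)
  { intros e He. set (K := c / (2 * b0)).
    assert (HK : 0 < K) by (apply Rdiv_lt_0_compat; lra).
    destruct (polynomial_decay p m K c b0 0 w v) as (T & C & HT & HC & Hdec); auto.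
    - lra.
    - unfold K. right. field. lra.
    - destruct (Rpower_neg_small C (K * c / 4) (e ^ 2)) as (T' & HT' & HT''); [lra|nra|nra|].
      exists (Rmax T T'). pose proof (Rmax_l T T'). pose proof (Rmax_r T T').
      split; [lra|]. intros t Ht.
      destruct (Hdec t ltac:(lra)) as [Hd _]. specialize (HT'' t ltac:(lra)).
      rewrite <- (Rabs_pos_eq e) by lra. apply Rsqr_le_abs_0. rewrite !Rsqr_pow2. lra. }
  set (k := 2 / (1 - p)) in *.
  assert (Hk : 0 < k) by (apply Rdiv_lt_0_compat; lra).
  (* Second pass: the rate K c/4 becomes 2k for the squares, hence k for w and v. *)
  set (K := 8 * k / c).
  assert (HK : 0 < K) by (apply Rdiv_lt_0_compat; lra).
  set (b := Rmin b0 (c / (2 * K))).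
  assert (Hbb0 : b <= b0) by apply Rmin_l.
  assert (HbK : b <= c / (2 * K)) by apply Rmin_r.
  assert (Hb : 0 < b) by (apply Rmin_glb_lt; [lra|apply Rdiv_lt_0_compat; lra]).
  (* This threshold for |w| is the one whose power 1-p is b, so w^2 <= b P beyond T0. *)
  destruct (Hsmall (Rpower b (1 / (1 - p))) (exp_pos _)) as (T0 & HT0 & Hw_small).
  destruct (polynomial_decay p m K c b T0 w v) as (T & C & HT & HC & Hdec); auto.
  { lra. }
  { replace (c / 2) with (K * (c / (2 * K))) by (field; lra).
    apply Rmult_le_compat_l; lra. }
  { intros t Ht. replace b with (Rpower (Rpower b (1 / (1 - p))) (1 - p)).
    - apply sqr_le_abs_pow; [lra|now apply Hw_small|apply exp_pos].
    - apply Rpower_root; lra. }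
  replace (K * c / 4) with (2 * k) in Hdec by (unfold K; field; lra).
  set (V0 := v 0 ^ 2 / 2 + potential p (w 0)).
  (* The potential is nonnegative on the confined range, so v^2 <= 2 V0. *)
  assert (HvM : forall t, 0 <= t -> Rabs (v t) <= 2 * V0 + 1).
  { intros t Ht.
    pose proof (energy_le_initial p m w v hp Hm Cw Cv Dw Dv t Ht) as HE. fold V0 in HE.
    assert (HU : 0 <= potential p (w t)).
    { apply Rle_trans with (2 := potential_ge p (w t) b0 hp ltac:(lra) (Hsq t Ht)).
      apply Rmult_le_pos; [apply Rdiv_le_0_compat; lra|apply abs_pow_ge0]. }
    rewrite <- (pow2_abs (v t)) in HE. nra. }
  destruct (linear_bound_at_zero v w2 (2 * V0 + 1)) as (L & HL & HvL); auto.
  { apply HC2. lra. }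
  destruct (superpower_bound w (w 0) 0 T C k (k - eps)) as (c1 & Hc1 & Hw1); try lra.
  { intros t Ht. rewrite Rpower_O, Rmult_1_r by exact Ht. apply Hconf. lra. }
  { intros t Ht. now apply Hdec. }
  (* Here (1+p)/(1-p) = k - 1, and the linear vanishing of v at 0 makes up for the missing power: 1
     + (k - 1 - eps) >= 0. *)
  destruct (superpower_bound v L 1 T C k ((1 + p) / (1 - p) - eps))
    as (c2 & Hc2 & Hv1); try lra.
  { replace ((1 + p) / (1 - p)) with (k - 1) by (unfold k; field; lra). lra. }
  { replace ((1 + p) / (1 - p)) with (k - 1) by (unfold k; field; lra). lra. }
  { intros t Ht. rewrite Rpower_1 by exact Ht. now apply HvL. }
  { intros t Ht. now apply Hdec. }
  exists c1, c2. repeat split; auto.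
  intros t Ht. rewrite (is_derive_unique w t (v t)); auto.
Qed.
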